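(* Let $D$ be a positive integer and let $\Gamma\subseteq\mathbb{R}^D$ be orthosymmetric, compact and convex. Then for every $\epsilon>0$, $$n_{\mathrm{gof}}\Big(\Gamma,\frac{\epsilon}{\sqrt2}\Big)^2\ge \frac{1}{64\log(2D)}\cdot\frac{n_{\mathrm{est}}(\Gamma,\epsilon)}{\epsilon^2}.$$
   Context: A set $\Gamma\subseteq\mathbb{R}^D$ is orthosymmetric if for every $\boldsymbol\theta=(\theta_1,\dots,\theta_D)\in\Gamma$ and every sign vector $(\epsilon_1,\dots,\epsilon_D)\in\{-1,1\}^D$, $(\epsilon_1\theta_1,\dots,\epsilon_D\theta_D)\in\Gamma$. Model: $\{\mathcal N(\boldsymbol\theta,I_D):\boldsymbol\theta\in\Gamma\}$. $n_{\mathrm{est}}(\Gamma,\epsilon)$ is the smallest $n$ such that from $n$ i.i.d. samples of $\mathcal N(\boldsymbol\theta,I_D)$ some estimator $\hat{\boldsymbol\theta}$ achieves $\sup_{\boldsymbol\theta\in\Gamma}\mathbb E\|\hat{\boldsymbol\theta}-\boldsymbol\theta\|_2^2\le\epsilon^2$. $n_{\mathrm{gof}}(\Gamma,\epsilon)$ is the smallest $n$ such that from $n$ i.i.d. samples of $\mathcal N(\boldsymbol\theta,I_D)$, $\boldsymbol\theta\in\Gamma$, some test $\psi\in\{0,1\}$ of $H_0:\boldsymbol\theta=\mathbf 0$ vs $H_1:\boldsymbol\theta\in\Gamma,\|\boldsymbol\theta\|_2\ge\epsilon$ has $\mathbb P_{\mathbf 0}(\psi=1)\le1/4$ and $\sup_{H_1}\mathbb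 P_{\boldsymbol\theta}(\psi=0)\le 1/4$. *)

(* Defs.v *)
From HB Require Import structures.
From mathcomp Require Import all_boot all_order all_algebra.
From mathcomp Require Import all_classical all_reals all_analysis.
Set Implicit Arguments. Unset Strict Implicit. Unset Printing Implicit Defensive.
Import Order.TTheory GRing.Theory Num.Theory.
Import numFieldNormedType.Exports.
Local Open Scope classical_set_scope.
Local Open Scope ring_scope.

Section gaussian_model.
Variable R : realType.

(* Iterated integral over k.-tuples, using the integrator I for each factor.
   For nonnegative measurable integrands this equals (Tonelli) the integral
   against the k-fold product measure. *)
Fixpoint iint (T : Type) (I : (T -> \bar R) -> \bar R) (k : nat)
  : (k.-tuple T -> \bar R) -> \bar R :=
  match k return (k.-tuple T -> \bar R) -> \bar R with
  | 0 => fun g => g [tuple]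
  | k'.+1 => fun g => I (fun x => iint I (fun t => g (cons_tuple x t)))
  end.

Definition std_normal_int (h : R -> \bar R) : \bar R :=
  (\int[normal_prob (0:R) 1]_x h x)%E.

Definition shift (D : nat) (theta : 'rV[R]_D) (z : D.-tuple R) : D.-tuple R :=
  [tuple theta ord0 i + tnth z i | i < D].

(* Integral against N(theta, I_D) on R^D (vectors represented as D-tuples). *)
Definition gauss_vec_int (D : nat) (theta : 'rV[R]_D)
  (h : D.-tuple R -> \bar R) : \bar R :=
  iint std_normal_int (fun z => h (shift theta z)).

(* Expectation of g(X_1,...,X_n), X_j i.i.d. N(theta, I_D);
   used for nonnegative measurable g only. *)
Definition gauss_sample_exp (D : nat) (theta : 'rV[R]_D) (n : nat)
  (g : n.-tuple (D.-tuple R) -> \bar R) : \bar R :=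
  iint (gauss_vec_int theta) g.

Definition sqdist (D : nat) (x : D.-tuple R) (theta : 'rV[R]_D) : R :=
  \sum_(i < D) (tnth x i - theta ord0 i) ^+ 2.

Definition norm2 (D : nat) (theta : 'rV[R]_D) : R :=
  Num.sqrt (\sum_(i < D) theta ord0 i ^+ 2).

Definition orthosymmetric (D : nat) (Gamma : set 'rV[R]_D) : Prop :=
  forall theta, Gamma theta ->
  forall s : 'I_D -> R, (forall i, s i = 1 \/ s i = -1) ->
  Gamma (\row_i (s i * theta ord0 i)).

Definition est_ok (D : nat) (Gamma : set 'rV[R]_D) (eps : R) (n : nat) : Prop :=
  exists f : n.-tuple (D.-tuple R) -> D.-tuple R,
    measurable_fun setT f /\
    forall theta, Gamma theta ->
      (gauss_sample_exp theta (fun X => (sqdist (f X) theta)%:E) <= (eps ^+ 2)%:E)%E.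

Definition gof_ok (D : nat) (Gamma : set 'rV[R]_D) (eps : R) (n : nat) : Prop :=
  exists psi : n.-tuple (D.-tuple R) -> bool,
    measurable (psi @^-1` [set true]) /\
    (gauss_sample_exp (0 : 'rV[R]_D) (fun X => ((psi X)%:R : R)%:E)
       <= (1 / 4 : R)%:E)%E /\
    forall theta, Gamma theta -> eps <= norm2 theta ->
      (gauss_sample_exp theta (fun X => ((~~ psi X)%:R : R)%:E)
         <= (1 / 4 : R)%:E)%E.

End gaussian_model.

Definition is_least_nat (P : nat -> Prop) (n : nat) : Prop :=
  P n /\ forall m, P m -> (n <= m)%N.

(* Main.v *)
(** Write [n] for the number of samples of a valid test.

    Testing.  For [theta] in [Gamma] with [|theta| >= eps / sqrt 2], randomise
    the signs of [theta].  The second moment of the likelihood ratio of this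
    mixture is [prod_i cosh (n theta_i^2) <= exp (2 n^2 sum_i theta_i^4)], and a
    valid test forces it to be at least [9/4], hence [n^2 sum_i theta_i^4 > 1/4].

    Truncation.  [Gamma] is solid, so this applies to truncations of its points,
    rescaled to norm [eps / sqrt 2].  For [t^2 = 1 / (2 n^2 eps^2)] it follows
    that [sum_i min (|theta_i|, t)^2 <= eps^2 / 2] on all of [Gamma].

    Estimation.  If [n eps^2 <= 1] the same argument shows that [Gamma] is so
    small that the zero estimator suffices.  Otherwise soft thresholding at
    level [t / 2] of the mean of about [64 log (2D) eps^2 n^2] samples has risk
    at most [3/2 sum_i min (|theta_i|, t)^2] plus a noise term that the factor
    [log (2D)] makes at most [eps^2 / 4]. *)
Require Import Defs.
From HB Require Import structures.
From mathcomp Require Import all_boot all_order all_algebra.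
From mathcomp Require Import all_classical all_reals all_analysis.
From mathcomp Require Import measurable_realfun ring lra.
Import Order.TTheory GRing.Theory Num.Theory.
Import numFieldNormedType.Exports.
Local Open Scope classical_set_scope.
Local Open Scope ring_scope.
Set Implicit Arguments. Unset Strict Implicit. Unset Printing Implicit Defensive.

Section density.
Context {R : realType} d (T : measurableType d).
Local Open Scope ereal_scope.

Lemma probability_integral_cst (P : probability T R) (r : R) :
  \int[P]_x r%:E = r%:E.
Proof. by rewrite integral_cst// [X in _ * X](@probability_setT _ _ _ P) mule1. Qed.

Definition has_density (P Q : probability T R) (w : T -> R) : Prop :=
  [/\ measurable_fun setT w, forall x, (0 <= w x)%R &
      forall f : T -> \bar R, measurable_fun setT f -> (forall x, 0 <= f x) ->
        \int[Q]_x f x = \int[P]_x (f x * (w x)%:E)].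

Lemma density_integral1 (P Q : probability T R) (w : T -> R) :
  has_density P Q w -> \int[P]_x (w x)%:E = 1.
Proof.
move=> [_ _ wP]; rewrite -[RHS](probability_integral_cst Q) wP//.
by apply: eq_integral => x _; rewrite mul1e.
Qed.

Lemma density_probability (P Q : probability T R) (w : T -> R) (A : set T) :
  has_density P Q w -> measurable A -> Q A = \int[P]_(x in A) (w x)%:E.
Proof.
move=> [_ _ wP] mA; transitivity (\int[Q]_x (\1_A x)%:E).
  by rewrite integral_indic// setIT.
rewrite wP; last 2 first.
- by apply/measurable_EFinP; exact: measurable_indic.
- by move=> x; rewrite lee_fin.
rewrite [RHS]integral_mkcond; apply: eq_integral => x _.
by rewrite patchE indicE; case: (x \in A); rewrite ?mul1e ?mul0e.
Qed.

End density.

Lemma distribution_density {R : realType} d d'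
    (T : measurableType d) (T' : measurableType d') (X : {mfun T >-> T'})
    (P Q : probability T R) (w : T' -> R) :
  measurable_fun setT w -> (forall x, 0 <= w x) ->
  has_density P Q (w \o X) -> has_density (distribution P X) (distribution Q X) w.
Proof.
move=> mw w0 [_ _ PQ]; split=> // f mf f0.
rewrite !ge0_integral_distribution//; last 2 first.
- by apply: emeasurable_funM => //; exact/measurable_EFinP.
- by move=> x; rewrite mule_ge0// lee_fin.
rewrite PQ//; first exact: measurableT_comp.
by move=> x; exact: f0.
Qed.

Lemma prod_density {R : realType} d1 d2
    (T1 : measurableType d1) (T2 : measurableType d2)
    (P1 Q1 : probability T1 R) (P2 Q2 : probability T2 R)
    (w1 : T1 -> R) (w2 : T2 -> R) :
  has_density P1 Q1 w1 -> has_density P2 Q2 w2 ->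
  has_density (P1 \x P2)%E (Q1 \x Q2)%E (fun p => w1 p.1 * w2 p.2).
Proof.
move=> [mw1 w1_ge0 PQ1] [mw2 w2_ge0 PQ2].
have mw1' : measurable_fun setT (fun p : T1 * T2 => w1 p.1).
  exact: measurableT_comp.
have mw2' : measurable_fun setT (fun p : T1 * T2 => w2 p.2).
  exact: measurableT_comp.
have mw : measurable_fun setT (fun p : T1 * T2 => w1 p.1 * w2 p.2).
  exact: measurable_funM.
split=> // [p|f mf f0]; first exact: mulr_ge0.
have mfw2 : measurable_fun setT (fun p => f p * (w2 p.2)%:E)%E.
  by apply: emeasurable_funM => //; exact/measurable_EFinP.
have fw2_ge0 p : (0 <= f p * (w2 p.2)%:E)%E by rewrite mule_ge0// lee_fin.
rewrite !fubini_tonelli1//; last 2 first.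
- by apply: emeasurable_funM => //; exact/measurable_EFinP.
- by move=> p; rewrite mule_ge0// lee_fin mulr_ge0.
transitivity (\int[Q1]_x \int[P2]_y (f (x, y) * (w2 y)%:E))%E.
  by apply: eq_integral => x _; apply: PQ2 => //; exact: measurableT_comp.
rewrite PQ1; first last.
- by move=> x; apply: integral_ge0 => y _; exact: (fw2_ge0 (x, y)).
- exact: (measurable_fun_fubini_tonelli_F (fun p => f p * (w2 p.2)%:E)%E).
apply: eq_integral => x _; rewrite -ge0_integralZr ?lee_fin//; last first.
  exact: (measurableT_comp mfw2).
by apply: eq_integral => y _; rewrite /= -muleA -EFinM mulrC.
Qed.

Section tuple_probability.
Context {R : realType} d (T : measurableType d).
Local Open Scope ereal_scope.

Definition cons_pair n (p : T * n.-tuple T) : n.+1.-tuple T :=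
  cons_tuple p.1 p.2.

Lemma measurable_cons_pair n : measurable_fun setT (@cons_pair n).
Proof. exact: measurable_cons. Qed.

HB.instance Definition _ n :=
  isMeasurableFun.Build _ _ _ _ (@cons_pair n) (@measurable_cons_pair n).

Fixpoint tuple_prob n : ('I_n -> probability T R) -> probability (n.-tuple T) R :=
  match n with
  | 0 => fun=> \d_[tuple]
  | n'.+1 => fun P =>
      distribution (P ord0 \x tuple_prob (fun i => P (lift ord0 i))) (@cons_pair n')
  end.

Lemma measurable_cons_tuple n (x : T) :
  measurable_fun setT (fun t : n.-tuple T => cons_tuple x t).
Proof. exact: (@measurable_cons _ _ _ _ (cst x) n id). Qed.

Lemma integral_tuple_prob0 (P : 'I_0 -> probability T R) (f : 0.-tuple T -> \bar R) :
  measurable_fun setT f -> \int[tuple_prob P]_t f t = f [tuple].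
Proof. by move=> mf; rewrite integral_dirac// diracT mul1e. Qed.

Lemma integral_tuple_probS n (P : 'I_n.+1 -> probability T R)
    (f : n.+1.-tuple T -> \bar R) :
  measurable_fun setT f -> (forall t, 0 <= f t) ->
  \int[tuple_prob P]_t f t =
  \int[P ord0]_x \int[tuple_prob (fun i => P (lift ord0 i))]_t f (cons_tuple x t).
Proof.
move=> mf f0; rewrite ge0_integral_distribution// fubini_tonelli1//.
- exact: measurableT_comp.
- by move=> p; exact: f0.
Qed.

Lemma measurable_integral_cons n (P : probability (n.-tuple T) R)
    (f : n.+1.-tuple T -> \bar R) :
  measurable_fun setT f -> (forall t, 0 <= f t) ->
  measurable_fun setT (fun x => \int[P]_t f (cons_tuple x t)).
Proof.
move=> mf f0.
apply: (@measurable_fun_fubini_tonelli_F _ _ _ _ _ P (f \o @cons_pair n)).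
- exact: measurableT_comp.
- by move=> p; exact: f0.
Qed.

Lemma iint_tuple_prob (S : Type) (I : (S -> \bar R) -> \bar R) n
    (phi : 'I_n -> S -> T) (P : 'I_n -> probability T R) (f : n.-tuple T -> \bar R) :
  (forall i (g : T -> \bar R), measurable_fun setT g -> (forall x, 0 <= g x) ->
     I (g \o phi i) = \int[P i]_x g x) ->
  measurable_fun setT f -> (forall t, 0 <= f t) ->
  iint I (fun t => f [tuple phi i (tnth t i) | i < n]) = \int[tuple_prob P]_t f t.
Proof.
elim: n => [|n IHn] in phi P f *.
  by move=> _ mf _; rewrite integral_tuple_prob0//=; congr f; exact: tuple0.
move=> IP mf f0; rewrite integral_tuple_probS// -IP; first last.
- by move=> x; exact: integral_ge0.
- exact: measurable_integral_cons.
rewrite /=; congr (I _); apply/funext => x /=.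
rewrite -(IHn (fun i => phi (lift ord0 i)))//; first last.
- by apply: measurableT_comp => //; exact: measurable_cons_tuple.
- by move=> i; exact: IP.
congr iint; apply/funext => t; congr f; apply: eq_from_tnth => i.
rewrite tnth_mktuple; case: (unliftP ord0 i) => [j ->|->].
  by rewrite !tnthS tnth_mktuple.
by rewrite !tnth0.
Qed.

Lemma measurable_prod_tnth n (w : 'I_n -> T -> R) :
  (forall i, measurable_fun setT (w i)) ->
  measurable_fun setT (fun t : n.-tuple T => \prod_i w i (tnth t i))%R.
Proof.
move=> mw; apply: measurable_prod => i _.
by apply: measurableT_comp => //; exact: measurable_tnth.
Qed.

Lemma tuple_prob_density n (P Q : 'I_n -> probability T R) (w : 'I_n -> T -> R) :
  (forall i, has_density (P i) (Q i) (w i)) ->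
  has_density (tuple_prob P) (tuple_prob Q) (fun t => \prod_i w i (tnth t i))%R.
Proof.
elim: n => [|n IHn] in P Q w * => PQw.
  split=> [|t|f mf _]; [by apply: measurable_prod_tnth; case|by rewrite big_ord0|].
  rewrite !integral_tuple_prob0 ?big_ord0 ?mule1//.
  by under eq_fun do rewrite big_ord0 mule1.
have mw i : measurable_fun setT (w i) by case: (PQw i).
have w0 i x : (0 <= w i x)%R by case: (PQw i).
apply: distribution_density; first exact: measurable_prod_tnth.
  by move=> t; exact: prodr_ge0.
have := prod_density (PQw ord0) (IHn _ _ _ (fun i => PQw (lift ord0 i))).
congr has_density; apply/funext => p.
rewrite /= big_ord_recl tnth0; congr (_ * _)%R.
by apply: eq_bigr => i _; rewrite tnthS.
Qed.

End tuple_probability.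

Section normal_law.
Context {R : realType}.
Implicit Types (a m s : R) (f : R -> \bar R).
Notation mu := (@lebesgue_measure R).
Local Open Scope ereal_scope.

Lemma ge0_integral_lebesgue_shift a f :
  measurable_fun setT f -> (forall x, 0 <= f x) ->
  \int[mu]_x f (a + x)%R = \int[mu]_x f x.
Proof.
move=> mf f0.
pose shift_a (x : measurableTypeR R) : measurableTypeR R := (a + x)%R.
have mshift : measurable_fun setT shift_a by apply: measurable_funD.
transitivity (\int[pushforward mu shift_a]_x f x).
  by rewrite ge0_integral_pushforward.
apply: eq_measure_integral => /= A mA _.
apply/esym/lebesgue_measure_unique => //= _ [[c d]] _ <-.
rewrite /pushforward (_ : _ @^-1` _ = `](c - a)%R, (d - a)%R]%classic); last first.
  by apply/seteqP; split => x /=; rewrite !in_itv/= ltrBlDl lerBrDl.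
rewrite !lebesgue_measure_itv/= !lte_fin ltrD2r; case: ifPn => // _.
by rewrite -!EFinD; congr EFin; ring.
Qed.

Lemma ge0_integral_normal_prob m s f :
  measurable_fun setT f -> (forall x, 0 <= f x) ->
  \int[normal_prob m s]_x f x = \int[mu]_x (f x * (normal_pdf m s x)%:E).
Proof.
move=> mf f0; have dom := normal_prob_dominates m s.
have mRN := measurable_int _ (Radon_Nikodym_SigmaFinite.f_integrable dom).
have mpdf : measurable_fun setT (fun x => (normal_pdf m s x)%:E).
  by apply/measurable_EFinP; exact: measurable_normal_pdf.
rewrite -(Radon_Nikodym_SigmaFinite.change_of_variables dom)//.
apply: ae_eq_integral => //; [exact: emeasurable_funM..|].
apply: ae_eqe_mul2l; apply: integral_ae_eq => //.
  exact: Radon_Nikodym_SigmaFinite.f_integrable.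
by move=> E _ mE; rewrite -Radon_Nikodym_SigmaFinite.f_integral.
Qed.

(* [measurableTypeR R], over which [normal_prob] is defined, and [R] have the
   same measurable sets but are distinct measurable types. *)
Definition id_measurableTypeR (x : measurableTypeR R) : R := x.

Lemma measurable_id_measurableTypeR : measurable_fun setT id_measurableTypeR.
Proof. by move=> _ A mA; rewrite setTI. Qed.

HB.instance Definition _ :=
  isMeasurableFun.Build _ _ _ _ id_measurableTypeR measurable_id_measurableTypeR.

Definition normal_law m s : probability R R :=
  distribution (normal_prob m s) id_measurableTypeR.

Lemma ge0_integral_normal_law m s f :
  measurable_fun setT f -> (forall x, 0 <= f x) ->
  \int[normal_law m s]_x f x = \int[mu]_x (f x * (normal_pdf m s x)%:E).
Proof.
by move=> mf f0; rewrite ge0_integral_distribution// ge0_integral_normal_prob.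
Qed.

Lemma normal_law_shift a m s f : s != 0%R ->
  measurable_fun setT f -> (forall x, 0 <= f x) ->
  \int[normal_law m s]_x f (a + x)%R = \int[normal_law (a + m)%R s]_x f x.
Proof.
move=> s0 mf f0.
rewrite [RHS]ge0_integral_normal_law; [|exact: mf|exact: f0].
rewrite [LHS]ge0_integral_normal_law; first last.
- by move=> x; exact: f0.
- by apply: measurableT_comp => //; exact: measurable_funD.
rewrite -[RHS](ge0_integral_lebesgue_shift a); first last.
- by move=> x; rewrite mule_ge0// lee_fin normal_pdf_ge0.
- apply: emeasurable_funM => //; apply/measurable_EFinP.
  exact: measurable_normal_pdf.
apply: eq_integral => x _; congr (_ * _%:E).
by rewrite !normal_pdfE// /normal_fun opprD addrACA subrr add0r.
Qed.

Lemma normal_law_density a s : s != 0%R ->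
  has_density (normal_law 0 s) (normal_law a s)
    (fun x => expR ((a * x - a ^+ 2 / 2) / s ^+ 2)).
Proof.
move=> s0; set w := fun x : R => expR _.
have mw : measurable_fun setT w.
  apply: measurableT_comp => //; apply: measurable_funM => //.
  by apply: measurable_funB => //; exact: measurable_funM.
split=> [//|x|f mf f0]; first exact: expR_ge0.
have mwE : measurable_fun setT (EFin \o w) by exact/measurable_EFinP.
have w0 x : 0 <= (w x)%:E by rewrite lee_fin expR_ge0.
have mfw : measurable_fun setT (fun x => f x * (w x)%:E) by exact: emeasurable_funM.
have fw0 x : 0 <= f x * (w x)%:E by rewrite mule_ge0.
rewrite [LHS]ge0_integral_normal_law; [|exact: mf|exact: f0].
rewrite [RHS]ge0_integral_normal_law; [|exact: mfw|exact: fw0].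
apply: eq_integral => x _; rewrite -muleA -EFinM; congr (_ * _%:E).
rewrite !normal_pdfE// mulrCA /w /normal_fun -expRD; congr (_ * expR _)%R.
by field.
Qed.

End normal_law.

Section row_vector_sums.
Context {R : realType} (D : nat).
Implicit Types (c t : R) (u v : 'rV[R]_D).

Definition dot u v : R := \sum_i u ord0 i * v ord0 i.

Definition powsum (k : nat) u : R := \sum_i u ord0 i ^+ k.

Lemma powsum2_ge0 u : 0 <= powsum 2 u.
Proof. by apply: sumr_ge0 => i _; exact: sqr_ge0. Qed.

Lemma powsum2D u v : powsum 2 (u + v) = powsum 2 u + powsum 2 v + 2 * dot u v.
Proof.
rewrite mulr_sumr -!big_split; apply: eq_bigr => i _ /=.
by rewrite mxE; ring.
Qed.

Lemma dot_scale_delta c i v : dot (c *: delta_mx ord0 i) v = c * v ord0 i.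
Proof.
rewrite /dot (bigD1 i)//= big1 ?addr0; first by rewrite !mxE !eqxx mulr1.
by move=> j /negPf ji; rewrite !mxE ji mulr0 mul0r.
Qed.

Lemma powsum2_scale_delta c i : powsum 2 (c *: delta_mx ord0 i) = c ^+ 2.
Proof.
rewrite /powsum; under eq_bigr do rewrite expr2.
by rewrite -/(dot _ _) dot_scale_delta !mxE !eqxx mulr1.
Qed.

Lemma sqr_norm2 v : norm2 v ^+ 2 = powsum 2 v.
Proof. by rewrite sqr_sqrtr// powsum2_ge0. Qed.

Lemma powsum4_le t v : (forall i, `|v ord0 i| <= t) ->
  powsum 4 v <= t ^+ 2 * powsum 2 v.
Proof.
move=> v_le; rewrite mulr_sumr; apply: ler_sum => i _.
rewrite (exprD _ 2 2) ler_wpM2r ?sqr_ge0// -real_normK ?num_real//.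
by rewrite lerXn2r ?nnegrE// (le_trans _ (v_le i)).
Qed.

Lemma normr_coord_le_norm2 v i : `|v ord0 i| <= norm2 v.
Proof.
rewrite -sqrtr_sqr ler_sqrt ?powsum2_ge0// (bigD1 i)//= lerDl.
by apply: sumr_ge0 => j _; exact: sqr_ge0.
Qed.

Definition clip t v : 'rV[R]_D := \row_i Num.min `|v ord0 i| t.

End row_vector_sums.

Section gaussian_vectors.
Context {R : realType} (D : nat).
Implicit Types theta eta u : 'rV[R]_D.
Local Open Scope ereal_scope.

Definition gauss_vec theta : probability (D.-tuple R) R :=
  tuple_prob (fun i => normal_law (theta ord0 i) 1).

Definition gauss_sample theta n : probability (n.-tuple (D.-tuple R)) R :=
  tuple_prob (fun=> gauss_vec theta).

Lemma gauss_vec_intE theta (f : D.-tuple R -> \bar R) :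
  measurable_fun setT f -> (forall z, 0 <= f z) ->
  gauss_vec_int theta f = \int[gauss_vec theta]_z f z.
Proof.
apply: (iint_tuple_prob (phi := fun i x => theta ord0 i + x)%R) => i g mg g0.
rewrite -[X in normal_law X](addr0 (theta ord0 i)) -normal_law_shift ?oner_eq0//.
rewrite ge0_integral_distribution//.
by apply: measurableT_comp => //; exact: measurable_funD.
Qed.

Lemma gauss_sample_expE theta n (f : n.-tuple (D.-tuple R) -> \bar R) :
  measurable_fun setT f -> (forall X, 0 <= f X) ->
  gauss_sample_exp theta f = \int[gauss_sample theta n]_X f X.
Proof.
move=> mf f0; rewrite /gauss_sample_exp -(iint_tuple_prob (I := gauss_vec_int theta)
    (phi := fun _ : 'I_n => @id (D.-tuple R)))//; last first.
  by move=> i g mg g0; exact: gauss_vec_intE.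
congr iint; apply/funext => X; congr f; apply: eq_from_tnth => i.
by rewrite tnth_mktuple.
Qed.

Definition sample_sum n (X : n.-tuple (D.-tuple R)) : 'rV[R]_D :=
  (\row_i \sum_j tnth (tnth X j) i)%R.

Definition gauss_lr theta n (X : n.-tuple (D.-tuple R)) : R :=
  expR (dot theta (sample_sum X) - n%:R / 2 * powsum 2 theta)%R.

Lemma measurable_sample_sum n i :
  measurable_fun setT (fun X : n.-tuple (D.-tuple R) => sample_sum X ord0 i).
Proof.
under eq_fun do rewrite mxE.
apply: measurable_sum => j.
exact: (measurableT_comp (measurable_tnth i) (measurable_tnth j)).
Qed.

Lemma measurable_expR_dot_sample_sum theta n : measurable_fun setT
  (fun X : n.-tuple (D.-tuple R) => expR (dot theta (sample_sum X))).
Proof.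
apply: measurableT_comp => //; apply: measurable_sum => i.
by apply: measurable_funM => //; exact: measurable_sample_sum.
Qed.

Lemma gauss_vec_density theta :
  has_density (gauss_vec 0) (gauss_vec theta)
    (fun z => expR (\sum_i (theta ord0 i * tnth z i - theta ord0 i ^+ 2 / 2)))%R.
Proof.
have -> : gauss_vec 0 = tuple_prob (fun=> normal_law 0 1).
  by congr tuple_prob; apply/funext => i; rewrite mxE.
have := tuple_prob_density (fun i => normal_law_density (theta ord0 i) (oner_neq0 R)).
congr has_density; apply/funext => z; rewrite expR_sum.
by apply: eq_bigr => i _; rewrite expr1n divr1.
Qed.

Lemma gauss_sample_density theta n :
  has_density (gauss_sample 0 n) (gauss_sample theta n) (@gauss_lr theta n).
Proof.
have := tuple_prob_density (fun _ : 'I_n => gauss_vec_density theta).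
congr has_density; apply/funext => X.
rewrite -expR_sum exchange_big/= /gauss_lr mulr_sumr -sumrB.
congr expR; apply: eq_bigr => i _; rewrite mxE sumrB -mulr_sumr; congr (_ - _)%R.
by rewrite sumr_const card_ord -mulr_natl; field.
Qed.

Lemma gauss_lrM theta eta n (X : n.-tuple (D.-tuple R)) :
  (gauss_lr theta X * gauss_lr eta X =
   expR (n%:R * dot theta eta) * gauss_lr (theta + eta) X)%R.
Proof.
rewrite /gauss_lr -!expRD powsum2D; congr expR.
have -> : dot (theta + eta) (sample_sum X) =
    (dot theta (sample_sum X) + dot eta (sample_sum X))%R.
  by rewrite -big_split; apply: eq_bigr => i _; rewrite mxE mulrDl.
by field.
Qed.

Lemma integral_gauss_lrM theta eta n :
  \int[gauss_sample 0 n]_X (gauss_lr theta X * gauss_lr eta X)%:E =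
  (expR (n%:R * dot theta eta))%:E.
Proof.
have [mlr lr0 _] := gauss_sample_density (theta + eta) n.
under eq_integral do rewrite gauss_lrM EFinM.
rewrite ge0_integralZl ?lee_fin ?expR_ge0//; first last.
- by move=> X _; rewrite lee_fin.
- exact/measurable_EFinP.
by rewrite (density_integral1 (gauss_sample_density _ _)) mule1.
Qed.

Lemma gauss_sample_mgf theta u n :
  \int[gauss_sample theta n]_X (expR (dot u (sample_sum X)))%:E =
  (expR (n%:R * (dot u theta + powsum 2 u / 2)))%:E.
Proof.
have [mlr lr0 lrP] := gauss_sample_density theta n.
have [mlru _ _] := gauss_sample_density u n.
rewrite lrP; first last.
- by move=> X; rewrite lee_fin expR_ge0.
- by apply/measurable_EFinP; exact: measurable_expR_dot_sample_sum.
transitivity (\int[gauss_sample 0 n]_X ((expR (n%:R / 2 * powsum 2 u))%:E *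
    (gauss_lr u X * gauss_lr theta X)%:E)).
  apply: eq_integral => X _; rewrite -!EFinM mulrA; congr (_ * _)%:E.
  by rewrite -expRD subrKC.
rewrite ge0_integralZl ?lee_fin ?expR_ge0//; first last.
- by move=> X _; rewrite lee_fin mulr_ge0// expR_ge0.
- by apply/measurable_EFinP; exact: measurable_funM.
by rewrite integral_gauss_lrM -EFinM -expRD; congr (expR _)%:E; field.
Qed.

End gaussian_vectors.

Section second_moment_method.
Context {R : realType} d (T : measurableType d).
Implicit Types (A : set T) (a b c : R).

(* AM-GM: [f <= c + f ^+ 2 / (4 * c)]. *)
Lemma integral_le_integral_sqr (mu : {measure set T -> \bar R}) A (f : T -> R) c :
  0 < c -> measurable A -> measurable_fun setT f -> (forall x, 0 <= f x) ->
  (\int[mu]_(x in A) (f x)%:E <=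
   c%:E * mu A + (4 * c)^-1%:E * \int[mu]_x (f x ^+ 2)%:E)%E.
Proof.
move=> c0 mA mf f0; have c40 : 0 <= (4 * c)^-1 by rewrite invr_ge0 mulr_ge0// ltW.
have mfA : measurable_fun A f by exact: measurable_funTS.
have mf2 : measurable_fun setT (fun x => (f x ^+ 2)%:E).
  by apply/measurable_EFinP; exact: measurable_funX.
have mcf2 : measurable_fun A (fun x => (4 * c)^-1%:E * (f x ^+ 2)%:E)%E.
  by apply: measurable_funTS; exact: measurable_funeM.
have f20 x : (0 <= (f x ^+ 2)%:E)%E by rewrite lee_fin sqr_ge0.
apply: (@le_trans _ _ (\int[mu]_(x in A) (c%:E + (4 * c)^-1%:E * (f x ^+ 2)%:E))%E).
  apply: ge0_le_integral => //.
  - by move=> x _; rewrite lee_fin.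
  - exact/measurable_EFinP.
  - exact: emeasurable_funD.
  - move=> x _; rewrite -EFinM -EFinD lee_fin -subr_ge0.
    rewrite (_ : _ - _ = (4 * c)^-1 * (f x - 2 * c) ^+ 2).
      by rewrite mulr_ge0// sqr_ge0.
    by field; rewrite gt_eqF.
rewrite ge0_integralD//; first last.
- by move=> x _; rewrite mule_ge0// lee_fin.
- by move=> x _; rewrite lee_fin ltW.
rewrite integral_cst// leeD2l// ge0_integralZl//; last exact: measurable_funTS.
by rewrite lee_wpmul2l// ?lee_fin// ge0_subset_integral.
Qed.

Lemma integral_sqr_sum (mu : {measure set T -> \bar R}) (S : finType)
    (f : S -> T -> R) :
  (forall s, measurable_fun setT (f s)) -> (forall s x, 0 <= f s x) ->
  (\int[mu]_x ((\sum_s f s x) ^+ 2)%:E =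
   \sum_s \sum_s' \int[mu]_x (f s x * f s' x)%:E)%E.
Proof.
move=> mf f0; have mff s s' : measurable_fun setT (fun x => (f s x * f s' x)%:E).
  by apply/measurable_EFinP; exact: measurable_funM.
have ff0 s s' x : (0 <= (f s x * f s' x)%:E)%E by rewrite lee_fin mulr_ge0.
transitivity (\int[mu]_x \sum_s \sum_s' (f s x * f s' x)%:E)%E.
  apply: eq_integral => x _; rewrite expr2 mulr_suml -sumEFin.
  by apply: eq_bigr => s _; rewrite mulr_sumr -sumEFin.
rewrite ge0_integral_sum//; first last.
- by move=> s x _; exact: sume_ge0.
- by move=> s; exact: emeasurable_sum.
by apply: eq_bigr => s _; rewrite ge0_integral_sum.
Qed.

Lemma finite_mixture_test_correlation_ge (P : probability T R) (S : finType)
    (Q : S -> probability T R) (w : S -> T -> R) (K : S -> S -> R) A a b :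
  (0 < #|S|)%N -> (forall s, has_density P (Q s) (w s)) ->
  (forall s s', \int[P]_x (w s x * w s' x)%:E = (K s s')%:E)%E ->
  measurable A -> 0 < a -> b < 1 ->
  (P A <= a%:E)%E -> (forall s, Q s (~` A) <= b%:E)%E ->
  ((1 - b) * #|S|%:R) ^+ 2 <= a * \sum_s \sum_s' K s s'.
Proof.
move=> S0 Qw KE mA a0 b1 PA QA; set M := \sum_s _.
have mw s : measurable_fun setT (w s) by case: (Qw s).
have w0 s x : 0 <= w s x by case: (Qw s).
pose mix x := \sum_s w s x; set N : R := (1 - b) * #|S|%:R.
have N0 : 0 < N by rewrite mulr_gt0 ?subr_gt0 ?ltr0n.
have power : (N%:E <= \int[P]_(x in A) (mix x)%:E)%E.
  under eq_integral do rewrite -sumEFin.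
  rewrite ge0_integral_sum//; first last.
  - by move=> s x _; rewrite lee_fin.
  - by move=> s; apply/measurable_EFinP; exact: measurable_funTS.
  rewrite /N mulr_natr -sumr_const -sumEFin; apply: lee_sum => s _.
  rewrite -(density_probability (Qw s))// -[A in leRHS]setCK.
  rewrite probability_setC//; last exact: measurableC.
  by rewrite EFinB leeB.
have second_moment : (\int[P]_x (mix x ^+ 2)%:E = M%:E)%E.
  rewrite integral_sqr_sum// -sumEFin; apply: eq_bigr => s _.
  by rewrite -sumEFin; apply: eq_bigr => s' _; exact: KE.
have mmix : measurable_fun setT mix by exact: measurable_sum.
have mix0 x : 0 <= mix x by exact: sumr_ge0.
pose c := N / (2 * a); have c0 : 0 < c by rewrite divr_gt0// mulr_gt0.
have := le_trans power (integral_le_integral_sqr P c0 mA mmix mix0).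
rewrite second_moment => /le_trans/(_ (leeD2r _ (lee_wpmul2l _ PA))).
rewrite lee_fin ltW// => /(_ isT); rewrite -!EFinM -EFinD lee_fin.
rewrite (_ : c * a = N / 2); last by rewrite /c; field; rewrite gt_eqF.
rewrite (_ : (4 * c)^-1 * M = a * M / (2 * N)).
  rewrite -lerBlDl ler_pdivlMr; last lra.
  by rewrite (_ : (N - N / 2) * (2 * N) = N ^+ 2)//; field.
by rewrite /c; field; rewrite !gt_eqF.
Qed.

End second_moment_method.

Section exponential_bounds.
Context {R : realType}.

Lemma expR_half_le2 : expR (1 / 2) <= 2 :> R.
Proof.
rewrite -[1 / 2]opprK expRN -[leRHS]invrK lef_pV2 ?posrE ?expR_gt0 ?invr_gt0//.
by apply: le_trans (expR_ge1Dx _); lra.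
Qed.

Lemma half_le_ln_double (x : R) : 1 <= x -> 1 / 2 <= ln (2 * x).
Proof.
move=> x1; rewrite -ler_expR lnK ?posrE; last by lra.
by apply: (le_trans expR_half_le2); lra.
Qed.

Lemma expRDexpRN_le (x : R) : expR x + expR (- x) <= 2 * expR (2 * x ^+ 2).
Proof.
wlog x0 : x / 0 <= x.
  move=> le_nonneg; have [/le_nonneg//|/ltW x0] := leP 0 x.
  by have := le_nonneg (- x); rewrite opprK sqrrN addrC; apply; rewrite oppr_ge0.
have [x12|x12] := leP x (1 / 2); last first.
  have xx : x <= 2 * x ^+ 2 by nra.
  rewrite mulr2n mulrDl mul1r lerD// ler_expR//.
  by apply: le_trans xx; lra.
have x2 : x ^+ 2 <= 1 / 4 by nra.
have expx : expR x <= (1 - x)^-1.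
  by rewrite -[x in expR x]opprK expRN lef_pV2 ?posrE ?expR_gt0 ?expR_ge1Dx//; lra.
have expNx : expR (- x) <= (1 + x)^-1.
  by rewrite expRN lef_pV2 ?posrE ?expR_gt0 ?expR_ge1Dx//; lra.
apply: (le_trans (lerD expx expNx)).
have -> : (1 - x)^-1 + (1 + x)^-1 = 2 / (1 - x ^+ 2).
  by field; apply/and3P; split; apply/eqP; nra.
apply: (@le_trans _ _ (2 * (1 + 2 * x ^+ 2))); last by rewrite ler_pM2l// expR_ge1Dx.
rewrite ler_pdivrMr; last by lra.
have := sqr_ge0 x; nra.
Qed.

Lemma card_signs D : #|{: {ffun 'I_D -> bool}}|%:R = 2 ^+ D :> R.
Proof. by rewrite card_ffun card_bool card_ord natrX. Qed.

Lemma sum_sign_expR D (a : 'I_D -> R) :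
  \sum_(s : {ffun 'I_D -> bool}) expR (\sum_i (-1) ^+ s i * a i) =
  \prod_i (expR (a i) + expR (- a i)).
Proof.
transitivity (\prod_i \sum_(b : bool) expR ((-1) ^+ b * a i)).
  by rewrite bigA_distr_bigA; apply: eq_bigr => s _; rewrite expR_sum.
by apply: eq_bigr => i _; rewrite big_bool/= expr1 expr0 mulN1r mul1r addrC.
Qed.

Lemma sum_sign_expR_le D (a : 'I_D -> R) :
  \sum_(s : {ffun 'I_D -> bool}) expR (\sum_i (-1) ^+ s i * a i) <=
  2 ^+ D * expR (2 * \sum_i a i ^+ 2).
Proof.
rewrite sum_sign_expR -[X in 2 ^+ X]card_ord -prodr_const.
rewrite mulr_sumr expR_sum -big_split.
by apply: ler_prod => i _; rewrite addr_ge0 ?expR_ge0//= expRDexpRN_le.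
Qed.

End exponential_bounds.

Section orthosymmetric_testing.
Context {R : realType} (D : nat).
Implicit Types (Gamma : set 'rV[R]_D) (theta : 'rV[R]_D) (s : {ffun 'I_D -> bool}).

Definition flip_signs s theta : 'rV[R]_D := \row_i ((-1) ^+ s i * theta ord0 i).

Lemma orthosymmetric_flip_signs Gamma s theta :
  orthosymmetric Gamma -> Gamma theta -> Gamma (flip_signs s theta).
Proof.
move=> oG Gt; apply: oG => // i.
by case: (s i); [right; rewrite expr1|left; rewrite expr0].
Qed.

Lemma norm2_flip_signs s theta : norm2 (flip_signs s theta) = norm2 theta.
Proof.
congr Num.sqrt; apply: eq_bigr => i _.
by rewrite mxE exprMn sqrr_sign mul1r.
Qed.

Lemma sum_expR_dot_flip_signs_le (c : R) theta :
  \sum_s \sum_s' expR (c * dot (flip_signs s theta) (flip_signs s' theta)) <=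
  (2 ^+ D) ^+ 2 * expR (2 * c ^+ 2 * powsum 4 theta).
Proof.
rewrite expr2 -mulrA -[X in X * _]card_signs mulr_natl -sumr_const.
apply: ler_sum => s _; pose a i := c * ((-1) ^+ s i * theta ord0 i ^+ 2).
have -> : 2 * c ^+ 2 * powsum 4 theta = 2 * \sum_i a i ^+ 2.
  rewrite -mulrA; congr (2 * _); rewrite mulr_sumr; apply: eq_bigr => i _.
  by rewrite /a [RHS]exprMn [in RHS]exprMn sqrr_sign mul1r -exprM.
have := sum_sign_expR_le a; congr (_ <= _); apply: eq_bigr => s' _.
congr expR; rewrite [RHS] mulr_sumr; apply: eq_bigr => i _.
by rewrite /a !mxE; ring.
Qed.

Lemma gauss_sample_exp_test n (psi : n.-tuple (D.-tuple R) -> bool) theta :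
  measurable (psi @^-1` [set true]) ->
  gauss_sample_exp theta (fun X => ((psi X)%:R : R)%:E) =
  gauss_sample theta n (psi @^-1` [set true]).
Proof.
move=> mpsi.
transitivity (\int[gauss_sample theta n]_X (\1_(psi @^-1` [set true]) X)%:E)%E.
  rewrite -gauss_sample_expE; last 2 first.
  - by apply/measurable_EFinP; exact: measurable_indic.
  - by move=> X; rewrite lee_fin.
  congr gauss_sample_exp; apply/funext => X.
  by rewrite indicE; congr ((nat_of_bool _)%:R)%:E; apply/idP/idP; rewrite inE.
by rewrite integral_indic// setIT.
Qed.

Lemma gof_ok_rejection_region Gamma (delta : R) n :
  gof_ok Gamma delta n ->
  exists A : set (n.-tuple (D.-tuple R)), [/\ measurable A,
    (gauss_sample 0 n A <= (1 / 4)%:E)%E &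
    forall theta, Gamma theta -> delta <= norm2 theta ->
      (gauss_sample theta n (~` A) <= (1 / 4)%:E)%E].
Proof.
move=> [psi [mpsi [type1 type2]]]; exists (psi @^-1` [set true]).
split=> [//||theta Gtheta theta_ge]; first by rewrite -gauss_sample_exp_test.
have acceptE : ~` (psi @^-1` [set true]) = (fun X => ~~ psi X) @^-1` [set true].
  by apply/seteqP; split => X /=; case: (psi X).
rewrite acceptE -(gauss_sample_exp_test (psi := fun X => ~~ psi X)); first exact: type2.
by rewrite -acceptE; exact: measurableC.
Qed.

Lemma gof_powsum4_gt Gamma (delta : R) n theta :
  orthosymmetric Gamma -> gof_ok Gamma delta n ->
  Gamma theta -> delta <= norm2 theta -> 1 / 4 < n%:R ^+ 2 * powsum 4 theta.
Proof.
move=> oG /gof_ok_rejection_region[A [mA type1 type2]] Gtheta theta_ge.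
have miss s : (gauss_sample (flip_signs s theta) n (~` A) <= (1 / 4)%:E)%E.
  by apply: type2; [exact: orthosymmetric_flip_signs|rewrite norm2_flip_signs].
have correlation : ((1 - 1 / 4) * 2 ^+ D) ^+ 2 <= 1 / 4 *
    \sum_s \sum_s' expR (n%:R * dot (flip_signs s theta) (flip_signs s' theta)).
  rewrite -card_signs; apply: (finite_mixture_test_correlation_ge _
    (fun s => gauss_sample_density (flip_signs s theta) n)
    (fun s s' => integral_gauss_lrM _ _ n) mA _ _ type1 miss); [|lra..].
  by rewrite -(ltr_nat R) card_signs exprn_gt0.
rewrite ltNge; apply/negP => powsum4_le.
have := sum_expR_dot_flip_signs_le n%:R theta.
have : expR (2 * n%:R ^+ 2 * powsum 4 theta) <= 2.
  by apply: le_trans expR_half_le2; rewrite ler_expR; lra.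
have : 0 < (2 ^+ D) ^+ 2 :> R by rewrite !exprn_gt0.
move: correlation; rewrite exprMn; nra.
Qed.

End orthosymmetric_testing.

Section solid_sets.
Context {R : realType} (D : nat).
Implicit Types (Gamma : set 'rV[R]_D) (theta eta v : 'rV[R]_D).

Definition solid Gamma : Prop := forall theta eta, Gamma theta ->
  (forall i, `|eta ord0 i| <= `|theta ord0 i|) -> Gamma eta.

Lemma solid_orthosymmetric Gamma : solid Gamma -> orthosymmetric Gamma.
Proof.
move=> sG theta Gtheta s s1; apply: (sG _ _ Gtheta) => i.
by rewrite mxE normrM; case: (s1 i) => ->; rewrite ?normrN normr1 mul1r.
Qed.

(* The scaled vector is a convex combination of [theta] and its reflection in
   the hyperplane where the coordinate [k] vanishes. *)
Lemma orthosymmetric_convex_scale_coord Gamma theta (k : 'I_D) (a : R) :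
  orthosymmetric Gamma -> convex_set (Gamma : set (convex_lmodType 'rV[R]_D)) ->
  Gamma theta -> `|a| <= 1 ->
  Gamma (\row_i if i == k then a * theta ord0 i else theta ord0 i).
Proof.
move=> oG cG Gtheta; rewrite ler_norml => /andP[a_geN1 a_le1].
pose sgn i : R := if i == k then -1 else 1.
have sgnP i : sgn i = 1 \/ sgn i = -1 by rewrite /sgn; case: ifP; [right|left].
have Greflect := oG _ Gtheta _ sgnP.
have p_ge0 : 0 <= (1 + a) / 2 by lra.
have p_le1 : (1 + a) / 2 <= 1 by lra.
have := cG _ _ (Itv01 p_ge0 p_le1) (mem_set Gtheta) (mem_set Greflect).
move=> /set_mem; congr Gamma; apply/rowP => i.
by rewrite /conv /= !mxE /sgn /unstable.onem; case: eqP => _; field.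
Qed.

Lemma orthosymmetric_convex_solid Gamma :
  orthosymmetric Gamma -> convex_set (Gamma : set (convex_lmodType 'rV[R]_D)) ->
  solid Gamma.
Proof.
move=> oG cG theta eta Gtheta le_eta.
suff Gmixed k : Gamma (\row_i if (i < k)%N then eta ord0 i else theta ord0 i).
  by have := Gmixed D; congr Gamma; apply/rowP => i; rewrite mxE ltn_ord.
elim: k => [|k IHk].
  by move: Gtheta; congr Gamma; apply/rowP => i; rewrite mxE.
have [kD|Dk] := ltnP k D; last first.
  move: IHk; congr Gamma; apply/rowP => i; rewrite !mxE.
  by rewrite !(leq_trans (ltn_ord i))// ltnW.
pose k' := Ordinal kD; pose a := eta ord0 k' / theta ord0 k'.
have etaE : a * theta ord0 k' = eta ord0 k'.
  have [t0|t0] := eqVneq (theta ord0 k') 0; last by rewrite divfK.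
  by have := le_eta k'; rewrite t0 normr0 normr_le0 mulr0 => /eqP.
have a_le1 : `|a| <= 1.
  have [t0|t0] := eqVneq (theta ord0 k') 0; first by rewrite /a t0 invr0 mulr0 normr0.
  by rewrite normf_div ler_pdivrMr ?normr_gt0// mul1r.
have := orthosymmetric_convex_scale_coord k' oG cG IHk a_le1.
congr Gamma; apply/rowP => i; rewrite !mxE [(i < k.+1)%N]ltnS [(i <= k)%N]leq_eqVlt.
have [->|nik] := eqVneq i k'; first by rewrite /= ltnn eqxx etaE.
by rewrite (_ : (i == k :> nat) = false)//; exact/negbTE.
Qed.

Lemma solid_rescale Gamma (delta : R) v : solid Gamma -> 0 < delta ->
  Gamma v -> delta <= norm2 v ->
  exists w, [/\ Gamma w, norm2 w = delta & forall i, `|w ord0 i| <= `|v ord0 i|].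
Proof.
move=> sG delta0 Gv delta_le; have norm_gt0 := lt_le_trans delta0 delta_le.
pose a := delta / norm2 v.
have a0 : 0 <= a by rewrite divr_ge0// ltW.
have w_le i : `|(a *: v) ord0 i| <= `|v ord0 i|.
  by rewrite mxE normrM ger0_norm// ler_piMl// ler_pdivrMr// mul1r.
exists (a *: v); split=> //; first exact: sG Gv w_le.
rewrite /norm2; under eq_bigr do rewrite mxE exprMn.
by rewrite -mulr_sumr sqrtrM ?sqr_ge0// sqrtr_sqr ger0_norm// divfK// gt_eqF.
Qed.

End solid_sets.

Section testable_solid_sets.
Context {R : realType} (D : nat) (Gamma : set 'rV[R]_D) (delta : R) (n : nat).
Hypothesis solid_Gamma : solid Gamma.
Hypothesis delta_gt0 : 0 < delta.
Hypothesis gof_Gamma : gof_ok Gamma delta n.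
Implicit Types (t : R) (theta v : 'rV[R]_D).

Lemma gof_sup_norm_gt t v : Gamma v -> delta <= norm2 v ->
  (forall i, `|v ord0 i| <= t) -> 1 < 4 * n%:R ^+ 2 * delta ^+ 2 * t ^+ 2.
Proof.
move=> Gv delta_le v_le.
have [w [Gw w_norm w_le]] := solid_rescale solid_Gamma delta_gt0 Gv delta_le.
have := gof_powsum4_gt (solid_orthosymmetric solid_Gamma) gof_Gamma Gw.
rewrite w_norm lexx => /(_ isT).
have := powsum4_le (fun i => le_trans (w_le i) (v_le i)).
rewrite -sqr_norm2 w_norm => /(ler_wpM2l (sqr_ge0 (n%:R : R))); lra.
Qed.

Lemma gof_powsum2_clip_le t theta : 0 <= t ->
  4 * n%:R ^+ 2 * delta ^+ 2 * t ^+ 2 <= 1 -> Gamma theta ->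
  powsum 2 (clip t theta) <= delta ^+ 2.
Proof.
move=> t0 nt_le1 Gtheta; rewrite -sqr_norm2 leNgt; apply/negP.
rewrite ltr_pXn2r ?nnegrE ?sqrtr_ge0 ?ltW// => /ltW delta_le.
have clip_ge0 i : 0 <= clip t theta ord0 i by rewrite mxE le_min normr_ge0.
have Gclip : Gamma (clip t theta).
  by apply: solid_Gamma Gtheta _ => i; rewrite ger0_norm// mxE ge_min lexx.
have clip_le i : `|clip t theta ord0 i| <= t.
  by rewrite ger0_norm// mxE ge_min lexx orbT.
by have := gof_sup_norm_gt Gclip delta_le clip_le; rewrite ltNge nt_le1.
Qed.

Lemma gof_powsum2_le theta :
  2 * n%:R * delta ^+ 2 <= 1 -> Gamma theta -> powsum 2 theta <= delta ^+ 2.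
Proof.
move=> n_small Gtheta; rewrite -sqr_norm2 leNgt; apply/negP.
rewrite ltr_pXn2r ?nnegrE ?sqrtr_ge0 ?ltW// => /ltW delta_le.
have [w [Gw w_norm _]] := solid_rescale solid_Gamma delta_gt0 Gtheta delta_le.
have := gof_sup_norm_gt Gw; rewrite w_norm lexx => /(_ delta isT).
have w_le i : `|w ord0 i| <= delta by rewrite -w_norm normr_coord_le_norm2.
have : 0 <= 2 * n%:R * delta ^+ 2 by rewrite mulr_ge0 ?sqr_ge0// mulr_ge0.
by move=> n_delta_ge0 /(_ w_le); nra.
Qed.

End testable_solid_sets.

Section soft_thresholding.
Context {R : realType}.
Implicit Types l k v theta z : R.

Definition soft_threshold l z : R := z - Num.max (- l) (Num.min l z).

Lemma measurable_soft_threshold l : measurable_fun setT (soft_threshold l).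
Proof.
apply: measurable_funB => //; apply: measurable_maxr => //.
exact: measurable_minr.
Qed.

Lemma normr_soft_threshold_error l theta z : 0 <= l ->
  `|soft_threshold l (theta + z) - theta| <=
  Num.min `|theta| (2 * l) + Num.max 0 (`|z| - l).
Proof.
move=> l0; rewrite /soft_threshold; set c := Num.max (- l) _.
set e := Num.max 0 _.
have e0 : 0 <= e by rewrite le_max lexx.
have ez : `|z| - l <= e by rewrite le_max lexx orbT.
have [z1 z2] : - `|z| <= z /\ z <= `|z| by apply/andP; rewrite -ler_norml.
have [t1 t2] : - `|theta| <= theta /\ theta <= `|theta|.
  by apply/andP; rewrite -ler_norml.
have cE : [\/ c = theta + z, c = l /\ l <= theta + z | c = - l /\ theta + z <= - l].
  rewrite /c; case: (leP l) => lz.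
    by constructor 2; split=> //; apply/max_idPr; lra.
  by case: (leP (- l)) => lz'; [constructor 1|constructor 3; split=> //; exact: ltW].
have [c1 c2] : c <= l /\ - l <= c.
  by rewrite le_max lexx ge_max ge_min lexx; split => //; rewrite andbT; lra.
rewrite ler_norml; apply/andP; case: (leP `|theta| (2 * l)) => _; last by split; lra.
by case: cE => [->|[->]|[->]] *; split; lra.
Qed.

Lemma sqr_max0_le_expR k z : 0 < k ->
  Num.max 0 z ^+ 2 <= 2 / k ^+ 2 * expR (k * z).
Proof.
move=> k0; case: (leP 0 z) => z0; last first.
  by rewrite expr0n mulr_ge0 ?expR_ge0// divr_ge0// sqr_ge0.
have := expR_ge1Dxn 1 (mulr_ge0 (ltW k0) z0).
rewrite -[2`!]/2%N exprMn => expR_ge.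
by rewrite mulrAC ler_pdivlMr ?exprn_gt0//; lra.
Qed.

Lemma sqr_soft_threshold_error l k theta z : 0 <= l -> 0 < k ->
  (soft_threshold l (theta + z) - theta) ^+ 2 <=
  3 / 2 * Num.min `|theta| (2 * l) ^+ 2 +
  6 / k ^+ 2 * expR (- (k * l)) * (expR (k * z) + expR (- k * z)).
Proof.
move=> l0 k0; have := normr_soft_threshold_error theta z l0.
set m := Num.min _ _; set e := Num.max 0 _ => error_le.
have e2 : e ^+ 2 <= 2 / k ^+ 2 * (expR (- (k * l)) * (expR (k * z) + expR (- k * z))).
  apply: le_trans (sqr_max0_le_expR _ k0) _.
  rewrite ler_pM2l ?divr_gt0 ?exprn_gt0// mulrBr addrC expRD.
  rewrite ler_pM2l ?expR_gt0// mulNr -mulrN.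
  have := expR_ge0 (k * z); have := expR_ge0 (k * - z).
  by case: (ger0P z) => _; lra.
apply: (@le_trans _ _ ((m + e) ^+ 2)).
  by rewrite -real_normK ?num_real// lerXn2r ?nnegrE// (le_trans _ error_le).
(* [2 * m * e <= m ^+ 2 / 2 + 2 * e ^+ 2] *)
by have := sqr_ge0 (m - 2 * e); nra.
Qed.

Definition subgaussian d (T : measurableType d) (P : probability T R) (Z : T -> R) v :=
  measurable_fun setT Z /\
  forall c, (\int[P]_x (expR (c * Z x))%:E <= (expR (v * (c ^+ 2 / 2)))%:E)%E.

Lemma measurable_expR_mul d (T : measurableType d) (Z : T -> R) (c : R) :
  measurable_fun setT Z -> measurable_fun setT (fun x => expR (c * Z x)).
Proof. by move=> mZ; apply: measurableT_comp => //; exact: measurable_funM. Qed.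

Lemma subgaussian_two_sided_mgf d (T : measurableType d) (P : probability T R)
    (Z : T -> R) v (c : R) : subgaussian P Z v ->
  (\int[P]_x (expR (c * Z x) + expR (- c * Z x))%:E <=
   (2 * expR (v * (c ^+ 2 / 2)))%:E)%E.
Proof.
move=> [mZ subgaussZ]; under eq_integral do rewrite EFinD.
have mexp a : measurable_fun setT (fun x => (expR (a * Z x))%:E).
  by apply/measurable_EFinP; exact: measurable_expR_mul.
rewrite ge0_integralD//.
by rewrite mulr_natl mulr2n EFinD leeD// -(sqrrN c).
Qed.

Lemma soft_threshold_risk d (T : measurableType d) (P : probability T R)
    (Z : T -> R) l v theta :
  0 < l -> 0 < v -> subgaussian P Z v ->
  (\int[P]_x ((soft_threshold l (theta + Z x) - theta) ^+ 2)%:E <=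
   (3 / 2 * Num.min `|theta| (2 * l) ^+ 2 +
    12 * (v / l) ^+ 2 * expR (- (l ^+ 2 / (2 * v))))%:E)%E.
Proof.
move=> l0 v0 subgaussZ; have [mZ _] := subgaussZ.
pose k := l / v; have k0 : 0 < k by rewrite divr_gt0.
set b := 3 / 2 * _; have b0 : 0 <= b by rewrite mulr_ge0// sqr_ge0.
pose q := 6 / k ^+ 2 * expR (- (k * l)).
have q0 : 0 <= q by rewrite mulr_ge0 ?expR_ge0// divr_ge0// sqr_ge0.
pose tails x := expR (k * Z x) + expR (- k * Z x).
have mtails : measurable_fun setT (fun x => (tails x)%:E).
  by apply/measurable_EFinP/measurable_funD; exact: measurable_expR_mul.
have tails0 x : (0 <= (tails x)%:E)%E by rewrite lee_fin addr_ge0// expR_ge0.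
apply: (@le_trans _ _ (\int[P]_x (b%:E + q%:E * (tails x)%:E))%E).
  apply: ge0_le_integral => //.
  - by move=> x _; rewrite lee_fin sqr_ge0.
  - apply/measurable_EFinP; apply: measurable_funX; apply: measurable_funB => //.
    apply: measurableT_comp; first exact: measurable_soft_threshold.
    exact: measurable_funD.
  - by apply: emeasurable_funD => //; exact: measurable_funeM.
  - move=> x _; rewrite -EFinM -EFinD lee_fin.
    exact: (sqr_soft_threshold_error _ _ (ltW l0) k0).
rewrite ge0_integralD//; first last.
- exact: measurable_funeM.
- by move=> x _; rewrite mule_ge0// lee_fin.
rewrite probability_integral_cst EFinD leeD2l// ge0_integralZl//.
have -> : 12 * (v / l) ^+ 2 * expR (- (l ^+ 2 / (2 * v))) =
    q * (2 * expR (v * (k ^+ 2 / 2))).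
  rewrite (_ : - _ = - (k * l) + v * (k ^+ 2 / 2)); last first.
    by rewrite /k; field; rewrite gt_eqF.
  by rewrite expRD /q /k; field; rewrite !gt_eqF.
by rewrite [leRHS]EFinM lee_wpmul2l ?lee_fin//; exact: subgaussian_two_sided_mgf.
Qed.

End soft_thresholding.

Section soft_threshold_estimator.
Context {R : realType} (D : nat).
Implicit Types (theta : 'rV[R]_D) (Gamma : set 'rV[R]_D) (l eps t : R).

Lemma subgaussian_sample_mean theta m i : (0 < m)%N ->
  subgaussian (gauss_sample theta m)
    (fun X => sample_sum X ord0 i / m%:R - theta ord0 i) m%:R^-1.
Proof.
move=> m0; have mR : m%:R != 0 :> R by rewrite pnatr_eq0 -lt0n.
split=> [|c].
  apply: measurable_funB => //; apply: measurable_funM => //.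
  exact: measurable_sample_sum.
pose u : 'rV[R]_D := (c / m%:R) *: delta_mx ord0 i.
have meanE X : (expR (c * (sample_sum X ord0 i / m%:R - theta ord0 i)))%:E =
    ((expR (- (c * theta ord0 i)))%:E * (expR (dot u (@sample_sum _ _ m X)))%:E)%E.
  by rewrite -EFinM -expRD dot_scale_delta; congr (expR _)%:E; field.
under eq_integral do rewrite meanE.
rewrite ge0_integralZl ?lee_fin ?expR_ge0//; last first.
  by apply/measurable_EFinP; exact: measurable_expR_dot_sample_sum.
rewrite gauss_sample_mgf -EFinM -expRD lee_fin ler_expR.
rewrite dot_scale_delta powsum2_scale_delta.
by rewrite [leLHS](_ : _ = m%:R^-1 * (c ^+ 2 / 2))//; field.
Qed.

Definition soft_mean m l (X : m.-tuple (D.-tuple R)) : D.-tuple R :=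
  [tuple soft_threshold l (sample_sum X ord0 i / m%:R) | i < D].

Lemma measurable_tnth_soft_mean m l i :
  measurable_fun setT (fun X => tnth (@soft_mean m l X) i).
Proof.
under eq_fun do rewrite tnth_mktuple.
apply: measurableT_comp; first exact: measurable_soft_threshold.
by apply: measurable_funM => //; exact: measurable_sample_sum.
Qed.

Lemma soft_mean_risk m l theta : (0 < m)%N -> 0 < l ->
  (gauss_sample_exp theta (fun X => (sqdist (@soft_mean m l X) theta)%:E) <=
   (3 / 2 * powsum 2 (clip (2 * l) theta) +
    D%:R * (12 / (m%:R * l) ^+ 2 * expR (- (m%:R * l ^+ 2 / 2))))%:E)%E.
Proof.
move=> m0 l0; have mR : 0 < m%:R :> R by rewrite ltr0n.
have merr i : measurable_fun setT
    (fun X => ((tnth (@soft_mean m l X) i - theta ord0 i) ^+ 2)%:E).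
  apply/measurable_EFinP; apply: measurable_funX; apply: measurable_funB => //.
  exact: measurable_tnth_soft_mean.
have err0 i X : (0 <= ((tnth (@soft_mean m l X) i - theta ord0 i) ^+ 2)%:E)%E.
  by rewrite lee_fin sqr_ge0.
under eq_fun do rewrite /sqdist -sumEFin.
rewrite gauss_sample_expE; last 2 first.
- exact: emeasurable_sum.
- by move=> X; exact: sume_ge0.
set noise := 12 / _ ^+ 2 * _.
have -> : D%:R * noise = \sum_(i < D) noise by rewrite sumr_const card_ord mulr_natl.
rewrite ge0_integral_sum// mulr_sumr -big_split -sumEFin; apply: lee_sum => i _ /=.
rewrite mxE.
have := soft_threshold_risk (theta ord0 i) l0 _ (subgaussian_sample_mean theta i m0).
rewrite invr_gt0 => /(_ mR).
congr (_ <= (_ + _)%:E)%E.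
  by apply: eq_integral => X _; rewrite tnth_mktuple subrKC.
have -> : l ^+ 2 / (2 * m%:R^-1) = m%:R * l ^+ 2 / 2 by field; rewrite gt_eqF.
by congr (_ * _); field; rewrite !gt_eqF.
Qed.

Lemma est_ok_zero Gamma eps n :
  (forall theta, Gamma theta -> powsum 2 theta <= eps ^+ 2) -> est_ok Gamma eps n.
Proof.
move=> radius; exists (fun=> [tuple 0 | i < D]); split; first exact: measurable_cst.
move=> theta Gtheta; rewrite gauss_sample_expE//; last first.
  by move=> X; rewrite lee_fin sumr_ge0// => i _; exact: sqr_ge0.
rewrite probability_integral_cst lee_fin; apply: le_trans (radius _ Gtheta).
by apply: ler_sum => i _; rewrite tnth_mktuple sub0r sqrrN.
Qed.

Lemma soft_mean_noise_le t (x : R) : (0 < D)%N -> 16 * ln (2 * D%:R) <= x ->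
  D%:R * (48 * t ^+ 2 / x ^+ 2 * expR (- (x / 8))) <= 3 / 8 * t ^+ 2.
Proof.
move=> D0 x_ge; have D1 : 1 <= D%:R :> R by rewrite ler1n.
have ln_ge := half_le_ln_double D1.
have tail_le : expR (- (x / 8)) <= (2 * D%:R)^-1.
  rewrite expRN lef_pV2 ?posrE ?expR_gt0 ?mulr_gt0 ?ltr0n//.
  by rewrite -[leLHS]lnK ?posrE ?mulr_gt0 ?ltr0n// ler_expR; lra.
have x2_ge : 64 <= x ^+ 2 by nra.
have factor_le : 48 * t ^+ 2 / x ^+ 2 <= 3 / 4 * t ^+ 2.
  by rewrite ler_pdivrMr; [have := sqr_ge0 t; nra|lra].
have -> : 3 / 8 * t ^+ 2 = D%:R * (3 / 4 * t ^+ 2 * (2 * D%:R)^-1).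
  by field; rewrite gt_eqF// ltr0n.
rewrite ler_wpM2l ?ler0n// ler_pM ?expR_ge0//.
by rewrite divr_ge0 ?sqr_ge0// mulr_ge0// sqr_ge0.
Qed.

Lemma est_ok_soft_mean Gamma eps t m : (0 < D)%N ->
  0 < t -> 2 * t ^+ 2 <= eps ^+ 2 ->
  (forall theta, Gamma theta -> powsum 2 (clip t theta) <= eps ^+ 2 / 2) ->
  16 * ln (2 * D%:R) <= m%:R * t ^+ 2 -> est_ok Gamma eps m.
Proof.
move=> D0 t0 t_le clip_le m_ge.
have mR : 0 < m%:R :> R.
  have := @half_le_ln_double R D%:R; rewrite ler1n => /(_ D0) ln_ge.
  by rewrite -(pmulr_lgt0 _ (exprn_gt0 2 t0)); lra.
have m0 : (0 < m)%N by rewrite -(ltr0n R).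
exists (@soft_mean m (t / 2)); split.
  by apply/measurable_fun_tnthP => i; exact: measurable_tnth_soft_mean.
move=> theta Gtheta; apply: (le_trans (soft_mean_risk theta m0 _)).
  by rewrite divr_gt0.
rewrite lee_fin (_ : 2 * (t / 2) = t); last by field.
have -> : m%:R * (t / 2) ^+ 2 / 2 = m%:R * t ^+ 2 / 8 by field.
have -> : 12 / (m%:R * (t / 2)) ^+ 2 = 48 * t ^+ 2 / (m%:R * t ^+ 2) ^+ 2.
  by field; rewrite !gt_eqF.
have := soft_mean_noise_le t D0 m_ge; have := clip_le _ Gtheta.
by have := sqr_ge0 eps; lra.
Qed.

End soft_threshold_estimator.

Lemma gof_est_ok (R : realType) (D : nat) (Gamma : set 'rV[R]_D) (eps : R) n :
  (0 < D)%N -> solid Gamma -> 0 < eps -> gof_ok Gamma (eps / Num.sqrt 2) n ->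
  est_ok Gamma eps (Num.truncn (64 * ln (2 * D%:R) * (n%:R ^+ 2 * eps ^+ 2))).
Proof.
move=> D0 sG eps0 gof.
have delta0 : 0 < eps / Num.sqrt 2 by rewrite divr_gt0// sqrtr_gt0.
have delta2 : (eps / Num.sqrt 2) ^+ 2 = eps ^+ 2 / 2.
  by rewrite exprMn exprVn sqr_sqrtr.
have [n_small|n_large] := leP (n%:R * eps ^+ 2) 1.
  apply: est_ok_zero => theta Gtheta.
  apply: (@le_trans _ _ (eps ^+ 2 / 2)); last by have := sqr_ge0 eps; lra.
  by rewrite -delta2 (gof_powsum2_le sG delta0 gof)// delta2; lra.
have n1 : 1 <= n%:R :> R.
  by rewrite ler1n lt0n; apply: contraL n_large => /eqP ->; rewrite mul0r ltr10.
set A := n%:R ^+ 2 * eps ^+ 2; have A1 : 1 <= A by rewrite /A; nra.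
have L_ge : 1 / 2 <= ln (2 * D%:R) :> R by rewrite half_le_ln_double// ler1n.
set L := ln _ in L_ge *.
pose t := Num.sqrt (2 * A)^-1.
have t2 : t ^+ 2 = (2 * A)^-1 by rewrite sqr_sqrtr// invr_ge0; lra.
have At2 : 2 * A * t ^+ 2 = 1 by rewrite t2 divff// gt_eqF//; lra.
have t0 : 0 < t by rewrite sqrtr_gt0 invr_gt0; lra.
apply: (est_ok_soft_mean (t := t)) => //.
- have : 1 <= A * eps ^+ 2.
    by rewrite /A (_ : _ * _ = (n%:R * eps ^+ 2) ^+ 2); [nra|ring].
  nra.
- move=> theta Gtheta; rewrite -delta2.
  apply: (gof_powsum2_clip_le sG delta0 gof (ltW t0) _ Gtheta).
  rewrite delta2 (_ : _ * t ^+ 2 = 2 * A * t ^+ 2); first by rewrite At2.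
  by rewrite /A; field.
have := truncnS_gt (64 * L * A); rewrite -natr1 -/L => m_gt.
have LA : 1 / 2 <= L * A by nra.
have -> : 16 * L = 32 * L * A * t ^+ 2 by rewrite -[LHS]mulr1 -At2; ring.
by rewrite ler_wpM2r ?sqr_ge0//; lra.
Qed.

Theorem mainTheorem3 (R : realType) (D : nat) (Gamma : set 'rV[R]_D)
  (eps : R) (n_gof n_est : nat) :
  (0 < D)%N ->
  orthosymmetric Gamma -> compact Gamma ->
  convex_set (Gamma : set (convex_lmodType 'rV[R]_D)) ->
  0 < eps ->
  is_least_nat (gof_ok Gamma (eps / Num.sqrt 2)) n_gof ->
  is_least_nat (est_ok Gamma eps) n_est ->
  (64 * ln (2 * D%:R))^-1 * (n_est%:R / eps ^+ 2) <= (n_gof%:R : R) ^+ 2.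
Proof.
move=> D0 oG _ cG eps0 [gof _] [_ least].
have L0 : 0 < ln (2 * D%:R) :> R.
  by rewrite (lt_le_trans _ (half_le_ln_double _)) ?ler1n//; lra.
have sG := orthosymmetric_convex_solid oG cG.
have n_est_le := least _ (gof_est_ok D0 sG eps0 gof).
rewrite mulrC ler_pdivrMr ?mulr_gt0// ler_pdivrMr ?exprn_gt0//.
apply: (@le_trans _ _ (64 * ln (2 * D%:R) * (n_gof%:R ^+ 2 * eps ^+ 2))).
  rewrite -(ler_nat R) in n_est_le; apply: le_trans n_est_le _.
  by rewrite truncn_le !mulr_ge0 ?sqr_ge0// ltW.
by rewrite mulrCA [leLHS]mulrA.
Qed.
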